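(* Let $n,p,c$ be positive integers such that $b:=pc-1$ is a positive integer. Let $k\in\{1,\dots,n\}$ and let $0<s_1<s_2<\cdots<s_k\le n$ be integers; put $s_0:=0$ and $s_{k+1}:=n$. Let $P'(s_1,\dots,s_k)$ be the probability that the set of positions $i\in\{1,\dots,n\}$ at which the $(b,n,p)$-shuffle has a d'-descent is exactly $\{s_1,\dots,s_k\}$. Then the following hold. (1) If $s_k<n$, then $$P'(s_1,\dots,s_k)=\frac{1}{b^n}\det\bigl(f'(i,j)\bigr)_{i,j=0,\dots,k},$$ where $$f'(i,j)=\begin{cases}\dbinom{s_{j+1}-s_i+b-1}{b-1} & (0\le i\le k,\ 0\le j\le k-1),\\[2mm] \dbinom{n-s_i+b-c}{b-c} & (0\le i\le k,\ j=k).\end{cases}$$ (2) If $s_k=n$, then $$P'(s_1,\dots,s_{k-1},n)=\frac{1}{b^n}\det\bigl(f'(i,j)\bigr)_{i,j=0,\dots,k-1},$$ where $$f'(i,j)=\begin{cases}\dbinom{s_{j+1}-s_i+b-1}{b-1} & (0\le i\le k-1,\ 0\le j\le k-2),\\[2mm] \dbinom{n-s_i+b-1}{b-1}-\dbinom{n-s_i+b-c}{b-c} & (0\le i\le k-1,\ j=k-1).\end{cases}$$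
   Context: Colored permutations. Let $[n]=\{1,\dots,n\}$, $\Sigma=[n]\times\mathbf{Z}_p$ with $\mathbf{Z}_p=\mathbf{Z}/p\mathbf{Z}$ (elements represented by $0,1,\dots,p-1$), and $T_q(i,r)=(i,r+q)$ for $q \in \mathbf{Z}_p$. $G_{p,n}$ is the group of bijections $\sigma:\Sigma\to\Sigma$ with $\sigma\circ T_1=T_1\circ\sigma$. An element $\sigma\in G_{p,n}$ is determined by the pairs $(\sigma(i),\sigma_c(i)):=\sigma(i,0)$, $i\in[n]$, and is written $\sigma=\bigl((\sigma(1),\sigma_c(1)),\dots,(\sigma(n),\sigma_c(n))\bigr)$. d'-descents. Order $\Sigma$ linearly by the dash-order $(1,0)<'(2,0)<'\cdots<'(n,0)<'(1,1)<'\cdots<'(n,1)<'\cdots<'(1,p-1)<'\cdots<'(n,p-1)$. $\sigma\in G_{p,n}$ has a d'-descent at $i$, for $1\le i\le n-1$, iff $(\sigma(i),\sigma_c(i))>'(\sigma(i+1),\sigma_c(i+1))$; it has a d'-descent at $n$ iff $\sigma_c(n)=p-1$. $(b,n,p)$-shuffle. This is the random element of $G_{p,n}$ obtained as follows. Choose $\mathbf{A}=(A_1,\dots,A_n)$ uniformly at random in $\{0,1,\dots,b-1\}^n$. Arrange $A_1,\dots,A_n$ in ascending order, $A_{i(1)}\le A_{i(2)}\le\cdots\le A_{i(n)}$, where equal labels are kept in increasing order of their indices, and define the permutation part of $\sigma$ by $\sigma(i(m))=m$ for $m=1,\dots,n$. Define the colors by $\sigma_c(i)\equiv A_i\pmod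 p$. (Example: $(b,n,p)=(5,4,3)$, $\mathbf A=(4,0,2,4)$ gives $\sigma=((3,1),(1,0),(2,2),(4,1))$.) Convention: $\binom{N}{K}=0$ whenever $N<K$ (in particular when $N<0\le K$) or $K<0$; so $f'(i,j)=0$ for those entries of the first type with $s_{j+1}<s_i$. *)

(* Defs.v *)
From HB Require Import structures.
From mathcomp Require Import all_boot all_order all_fingroup all_algebra.

Set Implicit Arguments.
Unset Strict Implicit.
Unset Printing Implicit Defensive.

Import GRing.Theory.
Local Open Scope ring_scope.

(* Z/p for p > 0, represented by 0, ..., p - 1. MathComp's 'Z_p is unsuitable *)
(* because 'Z_1 is Z/2, while one colour (p = 1) is allowed here.             *)
Notation color p := 'I_p.-1.+1.

(* The element i : 'I_n stands for the integer i.+1 of [n] = {1, ..., n}.     *)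
Notation Sigma n p := ('I_n * color p)%type.

Section ColoredPermutations.

Variables n p : nat.

Definition Tq (q : color p) (x : Sigma n p) : Sigma n p := (x.1, x.2 + q).

(* inZp 1 is the class of 1 mod p. *)
Definition Gpn : {set {perm Sigma n p}} :=
  [set sigma : {perm Sigma n p} |
    [forall x, sigma (Tq (inZp 1%N) x) == Tq (inZp 1%N) (sigma x)]].

Definition dash_lt (x y : Sigma n p) : bool :=
  (x.2 < y.2)%N || (x.2 == y.2) && (x.1 < y.1)%N.

(* ordS i is i + 1 as soon as i.+1 < n. *)
Definition ddescent (sigma : {perm Sigma n p}) (i : 'I_n) : bool :=
  if (i.+1 < n)%N then dash_lt (sigma (ordS i, 0)) (sigma (i, 0))
  else (sigma (i, 0)).2 == p.-1 :> nat.

Definition ddescents (sigma : {perm Sigma n p}) : {set 'I_n} :=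
  [set i | ddescent sigma i].

End ColoredPermutations.

Section Shuffle.

Variables b n p : nat.

Implicit Type A : {ffun 'I_n -> 'I_b}.

(* The sequence i(1), ..., i(n); path.sort is stable. *)
Definition label_order A : seq 'I_n :=
  sort (fun i j => A i <= A j)%N (enum 'I_n).

Lemma mem_label_order A i : i \in label_order A.
Proof. by rewrite mem_sort mem_enum. Qed.

Lemma index_label_order A i : (index i (label_order A) < n)%N.
Proof.
by rewrite -{2}(size_enum_ord n) -(size_sort (fun i j => A i <= A j)%N)
           index_mem mem_label_order.
Qed.

(* The position m such that i = i(m). *)
Definition shuffle_pos A i : 'I_n := Ordinal (index_label_order A i).

Lemma shuffle_pos_inj A : injective (shuffle_pos A).
Proof.
move=> i j /(congr1 val) /= eq_ij.
by rewrite -(nth_index i (mem_label_order A i)) eq_ij nth_index ?mem_label_order.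
Qed.

(* The colour inZp a is the class of a mod p. *)
Definition shuffle_fun A (x : Sigma n p) : Sigma n p :=
  Tq (inZp (A x.1)) (shuffle_pos A x.1, x.2).

Lemma shuffle_fun_inj A : injective (shuffle_fun A).
Proof.
move=> [i r] [j q] [] eq_ij.
have {eq_ij} -> : i = j by apply: (@shuffle_pos_inj A); apply: val_inj.
by move=> eq_rq; congr pair; apply: (addIr (inZp (A j))); apply: val_inj.
Qed.

Definition shuffle A : {perm Sigma n p} := perm (@shuffle_fun_inj A).

Lemma shuffle_in_Gpn A : shuffle A \in Gpn n p.
Proof.
rewrite inE; apply/forallP => -[i r].
by rewrite !permE /shuffle_fun /Tq /= addrAC.
Qed.

Lemma shuffle0 A i : shuffle A (i, 0) = (shuffle_pos A i, inZp (A i)).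
Proof. by rewrite permE /shuffle_fun /Tq /= add0r. Qed.

Definition shuffle_prob (sigma : {perm Sigma n p}) : rat :=
  #|[set A : {ffun 'I_n -> 'I_b} | shuffle A == sigma]|%:R
    / #|{: {ffun 'I_n -> 'I_b}}|%:R.

Definition ddescents_prob (S : {set 'I_n}) : rat :=
  \sum_(sigma in Gpn n p | ddescents sigma == S) shuffle_prob sigma.

End Shuffle.

(* The positions s_1, ..., s_k of [n] as a subset of 'I_n. *)
Definition position_set (n : nat) (s : seq nat) : {set 'I_n} :=
  [set i : 'I_n | i.+1 \in s].

(* s_i for 0 <= i <= k + 1, where s_0 = 0 and s_(k+1) = n. *)
Definition spos (n : nat) (s : seq nat) (i : nat) : nat :=
  nth 0%N (0%N :: rcons s n) i.

(* The binomial coefficient, 0 unless 0 <= K <= N. Signed arguments are       *)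
(* needed: s_(j+1) - s_i, and also b - c when p = 1, may be negative.         *)
Definition binz (N K : int) : rat :=
  match N, K with
  | Posz N', Posz K' => 'C(N', K')%:R
  | _, _ => 0
  end.

Section Matrices.

Variables (n b c k : nat) (s : seq nat).

Let sz (i : nat) : int := (spos n s i)%:Z.

Definition fmx_lt : 'M[rat]_k.+1 :=
  \matrix_(i < k.+1, j < k.+1)
    if (j < k)%N then binz (sz j.+1 - sz i + b%:Z - 1) (b%:Z - 1)
    else binz (n%:Z - sz i + b%:Z - c%:Z) (b%:Z - c%:Z).

Definition fmx_eq : 'M[rat]_k :=
  \matrix_(i < k, j < k)
    if (j < k.-1)%N then binz (sz j.+1 - sz i + b%:Z - 1) (b%:Z - 1)
    else binz (n%:Z - sz i + b%:Z - 1) (b%:Z - 1)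
         - binz (n%:Z - sz i + b%:Z - c%:Z) (b%:Z - c%:Z).

End Matrices.

(* Main.v *)
Require Import Defs.
From mathcomp Require Import all_boot all_order all_fingroup all_algebra zify ring.

Set Implicit Arguments.
Unset Strict Implicit.
Unset Printing Implicit Defensive.

Import GRing.Theory.
Local Open Scope ring_scope.

(** The shuffle turns a word A of n labels into a coloured permutation, and its
    d'-descents can be read off A: since the sort is stable, i is a d'-descent
    exactly when the label A (i + 1) precedes A i in the order that compares
    residues mod p first and labels second; the last position is a d'-descent
    when A n has residue p - 1.  The labels 0, ..., b - 1 with b = p c - 1 are
    carried to this order by the bijection a |-> (a mod p) c + a / p
    ([label_rank]), for which the residue p - 1 is the final segment of ranks
    at least (p - 1) c.  Hence P' is b ^ -n times the number of words over
    'I_b whose strict descents are at prescribed places and whose last letter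
    lies below, or not below, the threshold q = (p - 1) c = b + 1 - c
    ([card_ddescents]).

    Such words are counted by inclusion-exclusion.  A weakly increasing word of
    length x - lo followed by any word counted for the descents of s beyond x
    either descends at the junction or does not, so
      N lo (x :: s) + N lo s = multichoose (x - lo) * N x s
    ([nb_blocks_cons]).  Unrolled, this writes the number of words starting
    after s_i as an alternating sum, over the later positions s_j, of numbers
    of words starting after s_j.  These relations form a linear system whose
    matrix is the one of the statement; it has ones below the diagonal and
    zeros further down, and Cramer's rule identifies its determinant with the
    unknown attached to s_0 = 0 ([det_hessenberg]).

    The two cases differ only in the last column, which counts the increasing
    words with last letter below q, or not below q. *)

(** * Determinants of Hessenberg matrices *)

(** The hypothesis on x says that M sends the vector v of entries
    (-1) ^ j x_(j+1) to x_0 e_0: in row i > 0, the subdiagonal one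
    contributes (-1) ^ (i - 1) x_i, which cancels the sum over j >= i.
    Multiplying by the adjugate and reading the last entry gives the
    determinant, since deleting the first row and the last column leaves a
    unitriangular matrix. *)
Lemma det_hessenberg (R : comNzRingType) m (M : 'M[R]_m.+1) (x : nat -> R) :
    (forall i j : 'I_m.+1, j.+1 = i -> M i j = 1) ->
    (forall i j : 'I_m.+1, (j.+1 < i)%N -> M i j = 0) ->
    x m.+1 = 1 ->
    (forall i : 'I_m.+1,
       x i = \sum_(j < m.+1 | (i <= j)%N) (-1) ^+ (j - i) * M i j * x j.+1) ->
  \det M = x 0.
Proof.
move=> M1 M0 x_last xE.
pose v : 'cV[R]_m.+1 := \col_j ((-1) ^+ j * x j.+1).
have Mv : M *m v = x 0 *: delta_mx 0 0.
  apply/colP => i; rewrite !mxE andbT (bigID (fun j : 'I__ => (i <= j)%N)) /=.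
  have -> : \sum_(j < m.+1 | (i <= j)%N) M i j * v j 0 = (-1) ^+ i * x i.
    rewrite xE mulr_sumr; apply: eq_bigr => j le_ij.
    by rewrite mxE -{1}(subnKC le_ij) exprD; ring.
  case: (unliftP 0 i) => [i'|] ->; last first.
    by rewrite big1 ?mul1r ?mulr1 ?addr0.
  rewrite (bigD1 (widen_ord (leqnSn m) i')) -?ltnNge //= big1; last first.
    by move=> j /andP[ji ne_j]; rewrite M0 ?mul0r //=; move: ne_j ji;
       rewrite -val_eqE /= /bump /=; lia.
  by rewrite M1 ?mxE //= mulr0 addr0 /bump /= add1n exprS; ring.
have := congr1 (fun u => (\adj M *m u) ord_max 0) Mv.
rewrite mulmxA mul_adj_mx mul_scalar_mx -scalemxAr !mxE.
rewrite (bigD1 0) //= big1 ?addr0; last first.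
  by move=> j ne_j0; rewrite !mxE (negPf ne_j0) mulr0.
rewrite !mxE /= x_last !mulr1 /cofactor add0n.
have -> : \det (row' 0 (col' ord_max M)) = 1.
  rewrite -det_tr det_trig.
    by rewrite big1 // => i _; rewrite !mxE M1 //= /bump /= (leqNgt m) ltn_ord.
  apply/is_trig_mxP => i j lt_ij; rewrite !mxE M0 //= /bump /=.
  by rewrite (leqNgt m) ltn_ord.
by rewrite mulr1 /= ![_ * (-1) ^+ m]mulrC => /(can_inj (signrMK m)).
Qed.

(** * Words with prescribed descents *)
Section Words.
Variable b : nat.
Implicit Types (Q : pred 'I_b) (d : seq bool).

Definition is_descent (x y : 'I_b) : bool := (y < x)%N.

(** The number of words that may follow the letter a when d lists, position
    by position from a on, whether there is a strict descent, and Q constrains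
    the last letter (a itself if d is empty). *)
Fixpoint nb_cont Q d (a : 'I_b) : nat :=
  if d is e :: d' then (\sum_(a' | is_descent a a' == e) nb_cont Q d' a')%N
  else Q a.

Definition nb_words Q d : nat := (\sum_a nb_cont Q d a)%N.

Lemma sum_tuple_cons (T : finType) m (f : seq T -> nat) :
  (\sum_(t : m.+1.-tuple T) f t = \sum_a \sum_(t : m.-tuple T) f (a :: t))%N.
Proof.
rewrite pair_big /= (reindex (fun x : T * m.-tuple T => cons_tuple x.1 x.2)) //.
exists (fun t : m.+1.-tuple T => (thead t, behead_tuple t)) => [[a t] _|t _] /=.
  by rewrite theadE; congr pair; apply: val_inj.
by apply: val_inj; rewrite /= [in RHS](tuple_eta t).
Qed.

Lemma nb_contE Q d a :
  nb_cont Q d a = (\sum_(t : (size d).-tuple 'I_b)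
                    ((pairmap is_descent a t == d) && Q (last a t)))%N.
Proof.
elim: d a => [|e d IHd] a /=.
  by rewrite (big_pred1 [tuple]) // => t; apply/esym/eqP; exact: tuple0.
rewrite (sum_tuple_cons _ (fun t => nat_of_bool ((pairmap is_descent a t == e :: d)
                                    && Q (last a t))))%N /=.
rewrite big_mkcond /=; apply: eq_bigr => a' _; rewrite IHd.
case: eqP => [->|/eqP ne_e]; first by apply: eq_bigr => t _; rewrite eqseq_cons eqxx.
by rewrite big1 // => t _; rewrite eqseq_cons (negPf ne_e).
Qed.

Lemma nb_wordsE Q d (x0 : 'I_b) :
  nb_words Q d = (\sum_(t : (size d).+1.-tuple 'I_b)
    ((pairmap is_descent (head x0 t) (behead t) == d) && Q (last x0 t)))%N.
Proof.
rewrite (sum_tuple_cons _ (fun t => nat_of_bool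
  ((pairmap is_descent (head x0 t) (behead t) == d) && Q (last x0 t))))%N /=.
by apply: eq_bigr => a _; rewrite nb_contE.
Qed.

(** When the presence of a descent at a junction is left free, the two sides
    are independent: the left part is any increasing word, the right part any
    word of pattern d. *)
Lemma nb_words_merge Q m d :
  (nb_words Q (nseq m false ++ true :: d) + nb_words Q (nseq m false ++ false :: d)
   = nb_words predT (nseq m false) * nb_words Q d)%N.
Proof.
rewrite /nb_words -big_split big_distrl /=; apply: eq_bigr => a _.
elim: m a => [|m IHm] a /=; last first.
  by rewrite -big_split big_distrl /=; apply: eq_bigr => a' _; rewrite IHm.
rewrite mul1n [in RHS](bigID (fun a' => is_descent a a' == true)) /=.
by congr addn; apply: eq_bigl => a'; case: is_descent.
Qed.

Lemma nb_words_predC Q d :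
  (nb_words Q d + nb_words (predC Q) d = nb_words predT d)%N.
Proof.
rewrite /nb_words -big_split /=; apply: eq_bigr => a _.
elim: d a => [|e d IHd] a /=; first by case: (Q a).
by rewrite -big_split /=; apply: eq_bigr => a' _; rewrite IHd.
Qed.

(** Hockey-stick identity, written for the recursion on the first letter of
    an increasing word: i is the next letter, and all letters are below a + e. *)
Lemma sum_bin_above m a e :
  (\sum_(a <= i < a + e) 'C(a + e - i.+1 + m, m) = 'C(e + m, m.+1))%N.
Proof.
elim: e a => [|e IHe] a; first by rewrite addn0 big_geq // bin_small.
rewrite big_ltn ?addnS ?ltnS ?leq_addr // -addSn IHe.
by rewrite addSn subSS addKn addnC -binS.
Qed.

Lemma sum_ord_range q a (G : nat -> nat) : (q <= b)%N ->
  (\sum_(i < b | a <= i) (if i < q then G i else 0) = \sum_(a <= i < q) G i)%N.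
Proof.
move=> le_qb; rewrite -big_mkcondr /=.
rewrite (big_nat_widenl a 0) // (big_nat_widen 0 q b) // big_mkord.
by apply: eq_bigl => i.
Qed.

Lemma nb_cont_increasing q m (a : 'I_b) : (q <= b)%N ->
  nb_cont (fun x => (x < q)%N) (nseq m false) a =
  (if (a < q)%N then 'C(q - a.+1 + m, m) else 0)%N.
Proof.
move=> le_qb; elim: m a => [|m IHm] a /=.
  by rewrite bin0; case: ltnP.
under eq_bigl do rewrite eqbF_neg -leqNgt.
rewrite (eq_bigr _ (fun i _ => IHm i)).
rewrite (sum_ord_range a (fun i => 'C(q - i.+1 + m, m))) //.
case: ltnP => [lt_aq|le_qa]; last by rewrite big_geq.
have := sum_bin_above m a (q - a); rewrite subnKC 1?ltnW // => ->.
by congr 'C(_, _); lia.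
Qed.

Lemma nb_words_increasing q m : (q <= b)%N ->
  nb_words (fun x => (x < q)%N) (nseq m false) = 'C(q + m, m.+1).
Proof.
move=> le_qb; rewrite -(sum_bin_above m 0 q) add0n -sum_ord_range //.
by apply: eq_bigr => a _; rewrite nb_cont_increasing.
Qed.

Lemma eq_nb_words Q Q' d : Q =1 Q' -> nb_words Q d = nb_words Q' d.
Proof.
move=> eqQ; rewrite /nb_words; apply: eq_bigr => a _.
elim: d a => [|e d IHd] a /=; first by rewrite eqQ.
by apply: eq_bigr => a' _; exact: IHd.
Qed.

Lemma nb_words_increasingT m :
  nb_words predT (nseq m false) = 'C(b + m, m.+1).
Proof.
rewrite -nb_words_increasing //; apply: eq_nb_words => x.
by rewrite /= ltn_ord.
Qed.

Lemma nb_words_increasing_ge q m : (q <= b)%N ->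
  ('C(q + m, m.+1) + nb_words (fun x => (q <= x)%N) (nseq m false)
   = 'C(b + m, m.+1))%N.
Proof.
move=> le_qb; rewrite -nb_words_increasing // -nb_words_increasingT.
rewrite -[RHS](nb_words_predC (fun x : 'I_b => (x < q)%N)); congr addn.
by apply: eq_nb_words => x /=; rewrite -leqNgt.
Qed.

End Words.

(** * Inclusion-exclusion over blocks *)
Section Patterns.
Variables (b n : nat) (Q : pred 'I_b).

(** The descent pattern at the positions lo + 1, ..., n - 1, with descents at
    the entries of s only, written block by block so that
    [nb_words_merge] applies at each entry of s. *)
Fixpoint block_pattern (lo : nat) (s : seq nat) : seq bool :=
  if s is x :: s' then nseq (x - lo).-1 false ++ true :: block_pattern x s'
  else nseq (n - lo).-1 false.

Lemma map_false (T : eqType) (P : pred T) (l : seq T) :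
  {in l, forall y, ~~ P y} -> [seq P y | y <- l] = nseq (size l) false.
Proof.
move=> notP; rewrite -(size_map P); apply/all_pred1P; rewrite all_map.
by apply/allP => y /notP /= /negPf->.
Qed.

Lemma block_patternE lo s : (lo < n)%N -> path ltn lo s -> all (ltn^~ n) s ->
  block_pattern lo s = [seq x \in s | x <- iota lo.+1 (n - lo).-1].
Proof.
elim: s lo => [|x s IHs] lo lt_lo /=.
  by move=> _ _; rewrite map_false ?size_iota.
case/andP=> lt_lox path_xs /andP[lt_xn s_n].
have -> : ((n - lo).-1 = (x - lo).-1 + (n - x).-1.+1)%N by lia.
have s_gtx : all (ltn x) s by exact: (order_path_min ltn_trans).
rewrite iotaD map_cat /= map_false ?size_iota; last first.
  move=> y; rewrite mem_iota => lt_y; rewrite inE; apply/norP.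
  by split; [lia | apply/negP => /(allP s_gtx) /=; lia].
have -> : (lo.+1 + (x - lo).-1 = x)%N by lia.
rewrite inE eqxx IHs //; congr (_ ++ _ :: _).
apply/eq_in_map => y; rewrite mem_iota inE => lt_y.
by have /negPf-> : y != x by lia.
Qed.

(** For lo < n these are words of length n - lo, as a pattern is one shorter
    than the words it describes. *)
Definition nb_blocks lo s : rat := (nb_words Q (block_pattern lo s))%:R.

(** The number of weakly increasing words of length m over b letters; for m = 0 the
    truncated predecessor still gives 1. *)
Definition multichoose m : rat := 'C(b + m.-1, m)%:R.

(** Words with a free junction at x: those that descend there are counted by
    x :: s, the others by s. *)
Lemma nb_blocks_cons lo x s : (lo < x < n)%N -> path ltn x s ->
    all (ltn^~ n) s ->
  nb_blocks lo (x :: s)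
  = multichoose (x - lo) * nb_blocks x s - nb_blocks lo s.
Proof.
case/andP=> lt_lox lt_xn path_xs s_n.
apply/eqP; rewrite eq_sym subr_eq eq_sym; apply/eqP.
have -> : nb_blocks lo s = (nb_words Q
    (nseq (x - lo).-1 false ++ false :: block_pattern x s))%:R.
  rewrite /nb_blocks; congr (nb_words Q _)%:R.
  case: s path_xs s_n => [|y s] /= => [_ _|/andP[lt_xy _] /andP[lt_yn _]].
    by rewrite -[_ :: _]/(nseq (n - x).-1.+1 false) -nseqD;
       congr nseq; lia.
  rewrite -cat_cons -[_ :: nseq _ _]/(nseq (y - x).-1.+1 false) catA.
  by rewrite -nseqD; congr (nseq _ _ ++ _); lia.
rewrite /nb_blocks /= -natrD nb_words_merge nb_words_increasingT natrM.
by rewrite /multichoose prednK // subn_gt0.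
Qed.

Lemma nth_positions_lt (s : seq nat) i :
  (0 < n)%N -> all (ltn^~ n) s -> (nth 0%N (0%N :: s) i < n)%N.
Proof.
move=> n_gt0 s_n; case: i => [|i] //=; case: (ltnP i (size s)) => [lt_i|le_i].
  by apply: (allP s_n); apply: mem_nth.
by rewrite nth_default.
Qed.
Lemma nb_blocks_expand lo s : (lo < n)%N -> path ltn lo s -> all (ltn^~ n) s ->
  nb_blocks lo s =
    \sum_(j < size s) (-1) ^+ j * multichoose (nth 0%N s j - lo)
                      * nb_blocks (nth 0%N s j) (drop j.+1 s)
    + (-1) ^+ size s * nb_blocks lo [::].
Proof.
move=> lt_lo; elim: s => [|x s IHs] /=; first by rewrite big_ord0 add0r mul1r.
case/andP=> lt_lox path_xs /andP[lt_xn s_n].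
rewrite nb_blocks_cons ?lt_lox // IHs //; last exact: (path_le ltn_trans lt_lox path_xs).
rewrite big_ord_recl /= drop0 expr0 mul1r opprD addrA -mulNr exprS mulN1r.
congr (_ + _ + _); rewrite -sumrN; apply: eq_bigr => j _.
by rewrite /bump /= add1n exprS; ring.
Qed.

(** The unknowns of the linear system are the numbers of words placed after
    t_i with descents at the remaining entries of s; the conventional last
    unknown, equal to 1, carries the last column. *)
Lemma det_nb_blocks k (s : seq nat) (M : 'M[rat]_k.+1) :
    let t := nth 0%N (0%N :: s) in
    (0 < n)%N -> size s = k -> path ltn 0%N s -> all (ltn^~ n) s ->
    (forall i j, M i j =
       if (j < k)%N then
         if (t i <= t j.+1)%N then multichoose (t j.+1 - t i) else 0
       else nb_blocks (t i) [::]) ->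
  \det M = nb_blocks 0%N s.
Proof.
move=> t n_gt0 size_s path_s s_n ME.
have t_mono i j : (j <= k)%N -> (i < j)%N -> (t i < t j)%N.
  move=> le_jk lt_ij; have sorted_0s : sorted ltn (0%N :: s) by [].
  by apply: (sorted_ltn_nth ltn_trans 0%N sorted_0s); rewrite ?inE /= ?size_s //; lia.
have t_n i : (t i < n)%N by exact: nth_positions_lt.
pose x i := if (i <= k)%N then nb_blocks (t i) (drop i s) else 1.
have -> : nb_blocks 0%N s = x 0%N by rewrite /x /= drop0.
apply: det_hessenberg => [i j eq_ij|i j lt_ji||i].
- have lt_jk : (j < k)%N by have := ltn_ord i; rewrite -eq_ij.
  by rewrite ME lt_jk eq_ij leqnn subnn /multichoose bin0.
- have lt_ik := ltn_ord i.
  rewrite ME ifT; last by lia.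
  by rewrite leqNgt t_mono //.
- by rewrite /x ltnn.
have le_ik : (i <= k)%N by rewrite -ltnS.
rewrite /x le_ik nb_blocks_expand //; last first.
- by apply/allP => y /mem_drop /(allP s_n).
- rewrite /t; case: (val i) le_ik => [|i'] le_i'k /=; first by rewrite drop0.
  have: sorted ltn (drop i' s) by apply: drop_sorted; apply: path_sorted path_s.
  by rewrite (drop_nth 0%N) ?size_s.
rewrite [RHS]big_mkcond [RHS]big_ord_recr /= le_ik ME ltnn mulr1 size_drop size_s.
congr (_ + _).
rewrite -[RHS]big_mkcond /=.
pose F j := (-1) ^+ (j - i) * multichoose (t j.+1 - t i)
            * nb_blocks (t j.+1) (drop j.+1 s).
transitivity (\sum_(i <= j < k) F j).
  rewrite -[X in index_iota X](add0n i) big_addn big_mkord; apply: eq_bigr => j _.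
  by rewrite nth_drop drop_drop /F addnK /t /= addnC addSn.
rewrite (big_nat_widenl i 0) // big_mkord; apply: eq_bigr => j /= le_ij.
rewrite ME /= ltn_ord ifT //.
by rewrite ltnW // t_mono.
Qed.

End Patterns.

(** * The binomial entries *)

(** Weakly increasing words of length m over q letters, with integer arguments; q = 0
    makes the lower argument -1, for which [binz] vanishes as it should. *)
Lemma binz_words (m q : nat) : (0 < m)%N || (0 < q)%N ->
  binz (m%:Z + q%:Z - 1) (q%:Z - 1) = 'C(q + m.-1, m)%:R.
Proof.
case: q => [|q].
  by case: m => // m _; rewrite bin_small //=; case: (_ - 1).
move=> _; have -> : m%:Z + q.+1%:Z - 1 = (m + q)%N%:Z by lia.
have -> : q.+1%:Z - 1 = q%:Z by lia.
rewrite /binz -bin_sub ?leq_addl // addnK; case: m => [|m]; first by rewrite !bin0.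
by congr ('C(_, _)%:R); lia.
Qed.

Lemma binz_multichoose (b x y : nat) : (0 < b)%N ->
  binz (x%:Z - y%:Z + b%:Z - 1) (b%:Z - 1)
  = if (y <= x)%N then multichoose b (x - y) else 0.
Proof.
move=> b_gt0; case: leqP => [le_yx|lt_xy].
  by rewrite /multichoose -binz_words ?b_gt0 ?orbT // subzn.
have -> : b%:Z - 1 = b.-1%:Z by lia.
rewrite /binz; case E: (_ - 1) => [N|N] //; rewrite bin_small //; lia.
Qed.

(** * Shuffles as words of ranks *)

Section Shuffles.
Variables (p c b m : nat).
Hypotheses (p_gt0 : (0 < p)%N) (c_gt0 : (0 < c)%N) (b_def : b = (p * c - 1)%N).
Let n := m.+1.
Implicit Type A : {ffun 'I_n -> 'I_b}.

(** Stability of the sort: equal labels keep the order of their indices, so an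
    inversion can only come from a strict inversion of labels. *)
Lemma shuffle_pos_lt A (i j : 'I_n) : (i < j)%N ->
  (shuffle_pos A j < shuffle_pos A i)%N = (A j < A i)%N.
Proof.
move=> lt_ij /=.
have leA_total : total (fun i j => A i <= A j)%N by move=> x y; apply: leq_total.
have lt_trans : transitive (fun i j : 'I_n => (i < j)%N).
  by move=> y x z; apply: ltn_trans.
have enum_sorted : sorted (fun i j : 'I_n => (i < j)%N) (enum 'I_n).
  by have := iota_ltn_sorted 0 n; rewrite -val_enum_ord sorted_map.
have := sort_stable leA_total lt_trans enum_sorted.
rewrite -/(label_order A) => /(sorted_ltn_index _) index_lex.
have {}index_lex x y : (index x (label_order A) < index y (label_order A))%N ->
    (A x <= A y)%N && ((A y <= A x)%N ==> (x < y)%N).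
  apply: index_lex; rewrite ?mem_label_order // => v u w /=.
  by case/andP=> ? /implyP ? /andP[? /implyP ?]; apply/andP; split; lia.
apply/idP/idP => [/index_lex/andP[_]|].
  by rewrite implybE -ltnNge => /orP[//|]; lia.
apply: contraTT; rewrite -!leqNgt leq_eqVlt => /orP[/eqP eq_ij|/index_lex/andP[]//].
have /(@shuffle_pos_inj _ _ A) eq_ij' : shuffle_pos A i = shuffle_pos A j.
  exact: val_inj.
by rewrite eq_ij' ltnn in lt_ij.
Qed.

(** The rank of a in the order comparing residues mod p, then labels.  Each
    residue y < p - 1 is taken by exactly c labels y, y + p, ..., and the last
    residue by c - 1 of them; whence rank y * c + x for the label x * p + y. *)
Definition label_rank (a : nat) : nat := (a %% p * c + a %/ p)%N.

Lemma label_rank_bound (a : 'I_b) : (label_rank a < b)%N.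
Proof.
have : (a %/ p * p + a %% p < p * c - 1)%N by rewrite -divn_eq -b_def.
suff step : (a %/ p * p + a %% p < p * c - 1 -> label_rank a < p * c - 1)%N.
  by move/step; rewrite -b_def.
rewrite /label_rank.
move: (a %/ p)%N (a %% p)%N (ltn_pmod a p_gt0) => x y lt_yp lt_a.
have := c_gt0; case: (ltnP y.+1 p) => ? ?; first by nia.
have ? : p = y.+1 by lia.
subst p; nia.
Qed.

Lemma label_div_bound (a : 'I_b) : (a %/ p < c)%N.
Proof. by rewrite ltn_divLR //; have := ltn_ord a; lia. Qed.

Lemma label_rank_lt (a a' : 'I_b) : (label_rank a' < label_rank a)%N =
  (a' %% p < a %% p)%N || (a' %% p == a %% p)%N && (a' < a)%N.
Proof.
rewrite /label_rank {5}(divn_eq a' p) {5}(divn_eq a p).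
move: (label_div_bound a) (label_div_bound a').
move: (a %/ p)%N (a' %/ p)%N (a %% p)%N (a' %% p)%N => x x' y y' ltx ltx'.
case: (ltngtP y' y) => [lt_y|lt_y|->] /=; [nia|nia|].
by rewrite ltn_add2l ltn_add2r ltn_pmul2r.
Qed.

Lemma label_rank_top (a : 'I_b) :
  (p.-1 * c <= label_rank a)%N = (a %% p == p.-1)%N.
Proof.
rewrite /label_rank; move: (label_div_bound a) (ltn_pmod a p_gt0).
by move: (a %/ p)%N (a %% p)%N => x y ltx lty; case: eqP => [->|ne_y]; nia.
Qed.

Definition rank_ord (a : 'I_b) : 'I_b := Ordinal (label_rank_bound a).

Lemma rank_ord_inj : injective rank_ord.
Proof.
move=> a a' /(congr1 val) /= eq_rank; apply: val_inj => /=.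
have := label_rank_lt a a'; have := label_rank_lt a' a.
by rewrite eq_rank ltnn; case: (ltngtP (a %% p) (a' %% p))%N => //= _; lia.
Qed.

Definition rank_word A : n.-tuple 'I_b := [tuple rank_ord (A i) | i < n].

Lemma rank_word_bij : bijective rank_word.
Proof.
apply: inj_card_bij => [A A' /(congr1 (@tnth _ _)) eqAA'|].
  apply/ffunP => i; apply: rank_ord_inj.
  by have := congr1 (fun f => f i) eqAA'; rewrite !tnth_mktuple.
by rewrite card_tuple card_ffun !card_ord.
Qed.

Lemma ddescent_shuffle A (i : 'I_n) :
  ddescent (shuffle p A) i =
  if (i.+1 < n)%N then is_descent (rank_ord (A i)) (rank_ord (A (ordS i)))
  else (p.-1 * c <= rank_ord (A i))%N.
Proof.
rewrite /ddescent !shuffle0 /dash_lt /is_descent /=.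
case: ifP => [lt_in|_]; last by rewrite label_rank_top prednK.
rewrite label_rank_lt -val_eqE /= prednK //; congr (_ || _ && _).
by apply: shuffle_pos_lt; rewrite /= modn_small.
Qed.

Lemma card_ddescents (Q : pred 'I_b) (s : seq nat) : (0 < b)%N ->
    (forall x : 'I_b, Q x = ((p.-1 * c <= x)%N == (n \in s))) ->
  #|[set A : {ffun 'I_n -> 'I_b} | ddescents (shuffle p A) == position_set n s]|
  = nb_words Q [seq x \in s | x <- iota 1 m].
Proof.
move=> b_gt0 QE; pose x0 : 'I_b := Ordinal b_gt0.
rewrite (nb_wordsE _ _ x0) size_map size_iota.
rewrite (reindex rank_word) /=; last exact: onW_bij rank_word_bij.
rewrite -sum1dep_card big_mkcond; apply: eq_bigr => A _.
set w := rank_word A.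
have wE (i : 'I_n) : nth x0 w i = rank_ord (A i).
  by rewrite -tnth_nth tnth_mktuple.
have w_last : last x0 w = rank_ord (A ord_max).
  by rewrite -nth_last size_tuple -wE.
have w_eta : head x0 w :: behead w = w by case: (tupleP w).
have sz_w : size (behead w) = m by rewrite size_behead size_tuple.
have wd i : (i < m)%N -> nth false (pairmap (@is_descent b) (head x0 w) (behead w)) i
    = is_descent (nth x0 w i) (nth x0 w i.+1).
  by move=> lt_im; rewrite (nth_pairmap x0) ?sz_w // w_eta -nth_behead.
have sd i : (i < m)%N -> nth false [seq x \in s | x <- iota 1 m] i = (i.+1 \in s).
  by move=> lt_im; rewrite (nth_map 0%N) ?size_iota // nth_iota.
have ddE i : (i < m)%N ->
    ddescent (shuffle p A) (inord i) = is_descent (nth x0 w i) (nth x0 w i.+1).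
  move=> lt_im; have lt_Sn : (i.+1 < n)%N by [].
  have lt_n : (i < n)%N by apply: ltnW.
  by rewrite ddescent_shuffle inordK // lt_Sn -!wE /= inordK // modn_small.
rewrite -[LHS]/(nat_of_bool (ddescents _ == _)); congr nat_of_bool.
rewrite QE w_last; apply/eqP/andP => [/setP eqS|[/eqP eq_d /eqP eq_last]].
  split; last first.
    by have := eqS ord_max; rewrite !inE ddescent_shuffle ltnn => ->.
  apply/eqP/(@eq_from_nth _ false); rewrite size_pairmap sz_w ?size_map ?size_iota //.
  move=> i lt_im; rewrite wd // sd // -ddE //.
  by have := eqS (inord i); rewrite !inE inordK // ltnS ltnW.
apply/setP => i; rewrite !inE; have := ltn_ord i; rewrite ltnS leq_eqVlt.
case/orP => [/eqP eq_im|lt_im].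
  have -> : i = ord_max by apply: val_inj.
  by rewrite ddescent_shuffle ltnn eq_last.
by rewrite -[in LHS](inord_val i) ddE // -wd // eq_d sd.
Qed.

(** Summing over the group only regroups the words A according to their
    shuffle, all shuffles being in the group. *)
Lemma ddescents_probE (S : {set 'I_n}) :
  ddescents_prob b p S
  = (b%:R ^+ n)^-1 * #|[set A : {ffun 'I_n -> 'I_b} | ddescents (shuffle p A) == S]|%:R.
Proof.
rewrite /ddescents_prob /shuffle_prob -mulr_suml mulrC card_ffun !card_ord natrX.
congr (_ * _); rewrite -natr_sum; congr _%:R.
rewrite -[RHS]sum1_card (partition_big (@shuffle b n p)
  (fun sigma => (sigma \in Gpn n p) && (ddescents sigma == S))) /=; last first.
  by move=> A; rewrite inE shuffle_in_Gpn.
apply: eq_bigr => sigma /andP[_ /eqP dS]; rewrite -sum1_card; apply: eq_bigl => A.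
by rewrite !inE andbC; case: eqP => [->|] //=; rewrite dS eqxx.
Qed.

(** Here s is the set of all d'-descents, and s' its part below n; whether n
    belongs to s is recorded by Q. *)
Lemma ddescents_prob_det k (M : 'M[rat]_k.+1) (Q : pred 'I_b) (s s' : seq nat) :
    let t := nth 0%N (0%N :: s') in
    (0 < b)%N ->
    (forall x : 'I_b, Q x = ((p.-1 * c <= x)%N == (n \in s))) ->
    {in gtn n, s =i s'} ->
    size s' = k -> path ltn 0%N s' -> all (ltn^~ n) s' ->
    (forall i j, M i j =
       if (j < k)%N then binz ((t j.+1)%:Z - (t i)%:Z + b%:Z - 1) (b%:Z - 1)
       else (nb_words Q (nseq (n - t i).-1 false))%:R) ->
  ddescents_prob b p (position_set n s) = (b%:R ^+ n)^-1 * \det M.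
Proof.
move=> t b_gt0 QE ss' size_s' path_s' s'_n ME.
rewrite ddescents_probE (card_ddescents b_gt0 QE); congr (_ * _).
have -> : [seq y \in s | y <- iota 1 m] = block_pattern n 0 s'.
  rewrite block_patternE // subn0; apply/eq_in_map => y; rewrite mem_iota => lt_y.
  by apply: ss'; rewrite inE; lia.
symmetry; apply: det_nb_blocks => // i j.
by rewrite ME; case: ifP => // _; rewrite binz_multichoose.
Qed.

End Shuffles.

(** * The determinantal formula *)

Lemma path_rcons_max x y s : path ltn x (rcons s y) -> all (ltn^~ y) s.
Proof.
elim: s x => //= z s IHs x /andP[_ path_z]; rewrite (IHs _ path_z) andbT.
have /allP := order_path_min ltn_trans path_z; apply.
by rewrite mem_rcons mem_head.
Qed.

Lemma spos_cat n (s r : seq nat) i : (i <= size s)%N ->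
  spos n (s ++ r) i = nth 0%N (0%N :: s) i.
Proof. by case: i => // i lt_i; rewrite /spos /= rcons_cat nth_cat lt_i. Qed.

Theorem theorem1p3 (n p c b k : nat) (s : k.-tuple nat)
    (n_gt0 : (0 < n)%N) (p_gt0 : (0 < p)%N) (c_gt0 : (0 < c)%N)
    (b_def : b = (p * c - 1)%N) (b_gt0 : (0 < b)%N)
    (k_bounds : (1 <= k <= n)%N)
    (s_incr : path ltn 0%N s) (s_le_n : all (fun x => x <= n)%N s) :
  ((spos n s k < n)%N ->
     ddescents_prob b p (position_set n s)
       = (b%:R ^+ n)^-1 * \det (fmx_lt n b c k s))
  /\
  (spos n s k = n ->
     ddescents_prob b p (position_set n s)
       = (b%:R ^+ n)^-1 * \det (fmx_eq n b c k s)).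
Proof.
have size_s : size s = k := size_tuple s.
move: (tval s) size_s s_incr s_le_n k_bounds => {}s size_s s_incr s_le_n.
case/andP=> k_gt0 _.
case: n n_gt0 s_le_n => // m _ s_le_n.
(* b - c = q - 1 for the threshold q = p.-1 * c. *)
have qc : (p.-1 * c + c = b.+1)%N.
  by rewrite -mulSnr prednK // b_def subn1 prednK // muln_gt0 p_gt0.
have le_qb : (p.-1 * c <= b)%N by lia.
have last_lt y : (y < m.+1)%N ->
    (nb_words (fun x : 'I_b => x < p.-1 * c)%N (nseq (m.+1 - y).-1 false))%:R
    = binz (m.+1%:Z - y%:Z + b%:Z - c%:Z) (b%:Z - c%:Z).
  move=> lt_y; rewrite nb_words_increasing // prednK ?subn_gt0 //.
  by rewrite -binz_words ?subn_gt0 ?lt_y //; congr binz; lia.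
have last_ge y : (y < m.+1)%N ->
    (nb_words (fun x : 'I_b => p.-1 * c <= x)%N (nseq (m.+1 - y).-1 false))%:R
    = binz (m.+1%:Z - y%:Z + b%:Z - 1) (b%:Z - 1)
      - binz (m.+1%:Z - y%:Z + b%:Z - c%:Z) (b%:Z - c%:Z).
  move=> lt_y; rewrite -last_lt // nb_words_increasing //.
  have := nb_words_increasing_ge (m.+1 - y).-1 le_qb.
  rewrite binz_multichoose // ltnW // /multichoose prednK ?subn_gt0 // => <-.
  by rewrite natrD addrC addKr.
case/lastP: s size_s s_incr s_le_n => [/= k0|s' x]; first by rewrite -k0 in k_gt0.
rewrite size_rcons => size_s s_incr _; case: k size_s k_gt0 => // k [size_s] _.
have sposk : spos m.+1 (rcons s' x) k.+1 = x.
  by rewrite /spos /= !nth_rcons size_rcons size_s ltnSn ltnn eqxx.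
have s'_x := path_rcons_max s_incr.
rewrite sposk; split=> [lt_x|eq_x].
  have s_lt : all (ltn^~ m.+1) (rcons s' x).
    rewrite all_rcons /= lt_x; apply: sub_all s'_x => y /= lt_yx.
    exact: ltn_trans lt_x.
  have sz_s : size (rcons s' x) = k.+1 by rewrite size_rcons size_s.
  apply: (ddescents_prob_det p_gt0 c_gt0 b_def
            (Q := fun y => (y < p.-1 * c)%N) (s' := rcons s' x)) => //.
    have /negPf-> : m.+1 \notin rcons s' x.
      by apply/negP => /(allP s_lt); rewrite /= ltnn.
    by move=> y; rewrite eqbF_neg -ltnNge.
  move=> i j; rewrite mxE; cbv zeta beta; have lt_i := ltn_ord i.
  rewrite -[in spos _ _ i](cats0 (rcons s' x)) spos_cat ?sz_s //.
  case: (ltnP j k.+1) => [lt_jk|_].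
    by rewrite -[in spos _ _ _](cats0 (rcons s' x)) spos_cat ?sz_s.
  by rewrite last_lt // nth_positions_lt.
subst x.
apply: (ddescents_prob_det p_gt0 c_gt0 b_def
          (Q := fun y => (p.-1 * c <= y)%N) (s' := s')) => //.
- by move=> y; rewrite mem_rcons mem_head eqb_id.
- by move=> y; rewrite mem_rcons !inE => /ltn_eqF->.
- by move: s_incr; rewrite rcons_path => /andP[].
move=> i j; rewrite mxE; cbv zeta beta; have lt_i := ltn_ord i.
rewrite -cats1 (spos_cat _ _ (i := i)) ?size_s // -pred_Sn.
case: (ltnP j k) => [lt_jk|_]; first by rewrite spos_cat ?size_s.
by rewrite last_ge // nth_positions_lt.
Qed.
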